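(* Let $(\gamma,\widetilde\gamma)$ be a non-helical and non-planar Bertrand pair in Euclidean 3-space ($\gamma$ the Bertrand curve, $\widetilde\gamma$ its mate). Let $\widetilde\kappa,\widetilde\tau$ be the curvature and torsion of $\widetilde\gamma$, let $'$ be the derivative with respect to the arclength $s^{*}$ of $\widetilde\gamma$, and put $\widetilde f=\widetilde\tau/\widetilde\kappa$, $\widetilde g=\widetilde\tau'/\widetilde\kappa'$. Then the principal normal indicatrix $\gamma_n=N$ of the Bertrand curve $\gamma$ is planar if and only if $$\widetilde\kappa\widetilde\kappa''\widetilde f^{2}-3\widetilde\kappa'^{2}\widetilde g\widetilde f-(3\widetilde\kappa'^{2}-\widetilde\kappa\widetilde\kappa'')=0$$ holds identically.
   Context: Curves are smooth regular curves in $\mathbb{R}^3$ with non-vanishing curvature; $\gamma$ is parameterized by arclength $s$ with Frenet frame $T,N,B$, and $\widetilde\gamma$ by arclength $s^{*}$ with Frenet frame $\widetilde T,\widetilde N,\widetilde B$. The pair $(\gamma,\widetilde\gamma)$ is a Bertrand pair if there is a correspondence of points such that the principal normals at corresponding points are linearly dependent, $N=\epsilon\widetilde N$ with $\epsilon=\pm1$, and $\widetilde\gamma(s^{*})=\gamma(s)+\lambda N(s)$ with $\lambda\neq0$ constant. Non-helical means that torsion/curvature of each curve is not constant, non-planar that the torsions are non-zero; it is assumed that $\widetilde\kappa'\neq0$, $\widetilde f\neq0$ and $\widetilde g\neq\widetilde f$ at each point. The principal normal indicatrix of $\gamma$ is the curve $s\mapsto N(s)$ on the unit sphere; it is planar if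 it lies in a plane (its torsion vanishes identically). *)

(* Defs.v *)
From mathcomp Require Import all_boot all_order all_algebra.
From mathcomp Require Import all_classical all_reals all_analysis.

Set Implicit Arguments.
Unset Strict Implicit.
Unset Printing Implicit Defensive.

Import Order.TTheory GRing.Theory Num.Theory.
Import numFieldNormedType.Exports.

Local Open Scope classical_set_scope.
Local Open Scope ring_scope.

(* The norm `|_| on 'rV[R]_3 is the sup norm, so the Euclidean structure of
   3-space is set up separately. *)
Definition dot (R : realType) (u v : 'rV[R]_3) : R := (u *m v^T) 0 0.

Definition enorm (R : realType) (u : 'rV[R]_3) : R := Num.sqrt (dot u u).

(* Indices in 'I_3 are added modulo 3. *)
Definition cross (R : realType) (u v : 'rV[R]_3) : 'rV[R]_3 :=
  \row_(j < 3) (u 0 (j + 1) * v 0 (j + 2) - u 0 (j + 2) * v 0 (j + 1)).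

Definition open_interval (R : realType) (I : set R) : Prop :=
  [/\ open I, is_interval I & I !=set0].

(* C^oo on the open set I; the values of f outside I are irrelevant. *)
Definition smooth_on (R : realType) (V : normedModType R) (I : set R)
    (f : R -> V) : Prop :=
  forall (n : nat) (s : R), I s -> derivable (derive1n n f) s 1.

Definition tangent (R : realType) (gamma : R -> 'rV[R]_3) : R -> 'rV[R]_3 :=
  derive1 gamma.

Definition curvature (R : realType) (gamma : R -> 'rV[R]_3) (s : R) : R :=
  enorm (derive1 (tangent gamma) s).

Definition normal (R : realType) (gamma : R -> 'rV[R]_3) (s : R) : 'rV[R]_3 :=
  (curvature gamma s)^-1 *: derive1 (tangent gamma) s.

Definition binormal (R : realType) (gamma : R -> 'rV[R]_3) (s : R)
    : 'rV[R]_3 :=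
  cross (tangent gamma s) (normal gamma s).

(* Sign convention: B' = - tau N. *)
Definition torsion (R : realType) (gamma : R -> 'rV[R]_3) (s : R) : R :=
  - dot (derive1 (binormal gamma) s) (normal gamma s).

Definition arclength_curve (R : realType) (I : set R) (gamma : R -> 'rV[R]_3)
    : Prop :=
  [/\ smooth_on I gamma,
      forall s, I s -> enorm (tangent gamma s) = 1
    & forall s, I s -> curvature gamma s != 0].

(* The correspondence of points is s |-> s* = phi s, a smooth bijection between
   the arclength parameters of the two curves. *)
Definition bertrand_pair (R : realType) (I J : set R)
    (gamma gammat : R -> 'rV[R]_3) : Prop :=
  exists (phi : R -> R) (lambda eps : R),
    [/\ set_bij I J phi,
        smooth_on I phi,
        lambda != 0,
        eps = 1 \/ eps = -1
      & forall s, I s ->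
          normal gamma s = eps *: normal gammat (phi s) /\
          gammat (phi s) = gamma s + lambda *: normal gamma s].

Definition non_helical (R : realType) (I : set R) (gamma : R -> 'rV[R]_3)
    : Prop :=
  ~ exists c : R, forall s, I s -> torsion gamma s / curvature gamma s = c.

Definition non_planar (R : realType) (I : set R) (gamma : R -> 'rV[R]_3)
    : Prop :=
  forall s, I s -> torsion gamma s != 0.

Definition lies_in_plane (R : realType) (I : set R) (alpha : R -> 'rV[R]_3)
    : Prop :=
  exists (d : 'rV[R]_3) (c : R),
    d != 0 /\ forall s, I s -> dot d (alpha s) = c.

(* Main.v *)
(* In a Bertrand pair the scalar products of the tangent T of gamma with the
   tangent and the binormal of gammat are constant along the curves, which
   yields tau = g kappa + h on the mate, with constants g and h. Hence
   tau'/kappa' = g, and the hypothesis tau'/kappa' != tau/kappa says h != 0. With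
   w = kappa^2 + tau^2 the identity to be characterised reads
   w kappa'' = 3 kappa'^2 (kappa + g tau).
   If <d, N> is constant, differentiating it three times and eliminating
   <d, T> and <d, B> gives this identity. Conversely, the identity says that
   p = kappa' / w^(3/2) is constant, and then so is the vector
   (tau T + kappa B) / sqrt w - h p N, which is normal to the plane of N. *)
Require Import Defs.
From mathcomp Require Import all_boot all_order all_algebra.
From mathcomp Require Import all_classical all_reals all_analysis.
From mathcomp Require Import ring lra.

Set Implicit Arguments.
Unset Strict Implicit.
Unset Printing Implicit Defensive.

Import Order.TTheory GRing.Theory Num.Theory.
Import numFieldNormedType.Exports.

Local Open Scope ring_scope.
Local Open Scope classical_set_scope.

(** * Euclidean vector algebra in coordinates *)

Section Vectors.
Context {R : realType}.
Implicit Types (u v x y : 'rV[R]_3) (a : R).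

(** Splits vector identities into three coordinate identities, which [ring] can settle. The last
    index is spelled [1 + 1], here as in [dotE] and [crossE]. *)
Lemma ord3P (P : 'I_3 -> Prop) : P 0 -> P 1 -> P (1 + 1) -> forall i, P i.
Proof.
move=> P0 P1 P2 [[|[|[|//]]] i3].
- by rewrite (_ : Ordinal i3 = 0) //; exact: val_inj.
- by rewrite (_ : Ordinal i3 = 1) //; exact: val_inj.
- by rewrite (_ : Ordinal i3 = 1 + 1) //; exact: val_inj.
Qed.

Lemma dotE u v : dot u v = u 0 0 * v 0 0 + u 0 1 * v 0 1 + u 0 (1 + 1) * v 0 (1 + 1).
Proof.
rewrite /dot mxE !big_ord_recr big_ord0 /= add0r !mxE.
by congr (_ * _ + _ * _ + _ * _); congr (fun_of_matrix _ _ _); exact: val_inj.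
Qed.

Lemma crossE u v : [/\ cross u v 0 0 = u 0 1 * v 0 (1 + 1) - u 0 (1 + 1) * v 0 1,
  cross u v 0 1 = u 0 (1 + 1) * v 0 0 - u 0 0 * v 0 (1 + 1)
  & cross u v 0 (1 + 1) = u 0 0 * v 0 1 - u 0 1 * v 0 0].
Proof.
rewrite /cross !mxE.
by split; congr (_ * _ - _ * _); congr (fun_of_matrix _ _ _); exact: val_inj.
Qed.

Lemma dotC u v : dot u v = dot v u.
Proof. by rewrite !dotE; ring. Qed.

Lemma dotDl u v x : dot (u + v) x = dot u x + dot v x.
Proof. by rewrite !dotE !mxE; ring. Qed.

Lemma dotZl a u v : dot (a *: u) v = a * dot u v.
Proof. by rewrite !dotE !mxE; ring. Qed.

Lemma dot0l u : dot 0 u = 0.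
Proof. by rewrite -(scale0r u) dotZl mul0r. Qed.

Lemma dotDr u v x : dot x (u + v) = dot x u + dot x v.
Proof. by rewrite !(dotC x) dotDl. Qed.

Lemma dotZr a u v : dot v (a *: u) = a * dot v u.
Proof. by rewrite !(dotC v) dotZl. Qed.

Lemma dot_ge0 u : 0 <= dot u u.
Proof. by rewrite dotE -!expr2 !addr_ge0 ?sqr_ge0. Qed.

Lemma enorm_sqr u : enorm u ^+ 2 = dot u u.
Proof. by rewrite sqr_sqrtr ?dot_ge0. Qed.

Lemma dot_crossl u v : dot u (cross u v) = 0.
Proof. by rewrite dotE; case: (crossE u v) => -> -> ->; ring. Qed.

Lemma dot_crossr u v : dot v (cross u v) = 0.
Proof. by rewrite dotE; case: (crossE u v) => -> -> ->; ring. Qed.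

(** Alternation of the triple product; it turns the definition of torsion into the scalar product of
    [N'] and [B]. *)
Lemma dot_cross_swap u v x : dot (cross u x) v = - dot x (cross u v).
Proof.
rewrite !dotE; case: (crossE u v) => -> -> ->; case: (crossE u x) => -> -> ->.
by ring.
Qed.

Lemma dot_cross_cross u v :
  dot (cross u v) (cross u v) = dot u u * dot v v - dot u v ^+ 2.
Proof. by rewrite !dotE; case: (crossE u v) => -> -> ->; ring. Qed.

Lemma cross_id u : cross u u = 0.
Proof.
apply/rowP; apply: ord3P; case: (crossE u u) => E0 E1 E2;
  by rewrite ?E0 ?E1 ?E2 mxE; ring.
Qed.

Lemma crossDr u v x : cross u (v + x) = cross u v + cross u x.
Proof. by apply/rowP => i; rewrite !mxE; ring. Qed.

Lemma crossZl a u v : cross (a *: u) v = a *: cross u v.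
Proof. by apply/rowP => i; rewrite !mxE; ring. Qed.

Lemma crossZr a u v : cross u (a *: v) = a *: cross u v.
Proof. by apply/rowP => i; rewrite !mxE; ring. Qed.

Lemma cross_cross u v : cross u (cross u v) = dot u v *: u - dot u u *: v.
Proof.
rewrite !dotE.
case: (crossE u (cross u v)); case: (crossE u v) => -> -> -> E0 E1 E2.
by apply/rowP; apply: ord3P; rewrite ?E0 ?E1 ?E2 !mxE; ring.
Qed.

Lemma orthonormal_expansion u v x : dot u u = 1 -> dot v v = 1 -> dot u v = 0 ->
  x = dot x u *: u + dot x v *: v + dot x (cross u v) *: cross u v.
Proof.
move=> uu vv uv.
(* A polynomial identity valid for all [u] and [v]. Its left factor is the Gram determinant, which
   equals 1 for an orthonormal pair. *)
have E : (dot u u * dot v v - dot u v ^+ 2) *: x =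
    (dot x u * dot v v - dot x v * dot u v) *: u +
    (dot x v * dot u u - dot x u * dot u v) *: v +
    dot x (cross u v) *: cross u v.
  case: (crossE u v); move: (cross u v) => w E0 E1 E2; rewrite !dotE.
  by apply/rowP; apply: ord3P; rewrite !mxE E0 E1 E2; ring.
by move: E; rewrite uu vv uv expr0n !mulr1 !mulr0 !subr0 scale1r.
Qed.

End Vectors.

(** * Differentiation rules for scalar, vector and matrix functions of one variable *)

Section Calculus.
Context {R : realType}.

Lemma is_derive_mxP m n (M : R -> 'M[R]_(m, n)) (s : R) (D : 'M[R]_(m, n)) :
  is_derive s 1 M D <-> forall i j, is_derive s 1 (fun r => M r i j) (D i j).
Proof.
split=> [[Ms <-] i j|MD].
  rewrite derive_mx// mxE; apply: derivableP.
  by move/derivable_mxP : Ms.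
have Ms : derivable M s 1 by apply/derivable_mxP => i j; case: (MD i j).
split=> //; rewrite derive_mx//; apply/matrixP => i j; rewrite mxE.
by case: (MD i j).
Qed.

(* The scalar and pointwise forms of the library rules: the derivatives then
   live in [R] seen as a ring rather than as a normed module, as [ring] and
   [lra] expect. *)
Lemma is_derive_eqR (f : R -> R) (s d e : R) :
  is_derive s 1 f d -> d = e -> is_derive s 1 f e.
Proof. by move=> ? <-. Qed.

Lemma is_derive_cstR (a s : R) : is_derive s 1 (fun=> a) (0 : R).
Proof. exact: is_derive_cst. Qed.

Lemma is_derive_add (f g : R -> R) (s df dg : R) :
  is_derive s 1 f df -> is_derive s 1 g dg ->
  is_derive s 1 (fun r => f r + g r) (df + dg).
Proof. exact: is_deriveD. Qed.

Lemma is_derive_sub (f g : R -> R) (s df dg : R) :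
  is_derive s 1 f df -> is_derive s 1 g dg ->
  is_derive s 1 (fun r => f r - g r) (df - dg).
Proof. exact: is_deriveB. Qed.

Lemma is_derive_mul (f g : R -> R) (s df dg : R) :
  is_derive s 1 f df -> is_derive s 1 g dg ->
  is_derive s 1 (fun r => f r * g r) (df * g s + f s * dg).
Proof.
move=> fs gs; apply: (is_derive_eq (is_deriveM fs gs)).
by rewrite addrC; congr (_ + _); rewrite [LHS]mulrC.
Qed.

Lemma is_derive_scale (f : R -> R) m n (M : R -> 'M[R]_(m, n)) (s df : R) dM :
  is_derive s 1 f df -> is_derive s 1 M dM ->
  is_derive s 1 (fun r => f r *: M r) (df *: M s + f s *: dM).
Proof.
move=> fs /is_derive_mxP Ms; apply/is_derive_mxP => i j.
rewrite !mxE; under [X in is_derive _ _ X]funext do rewrite mxE.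
exact: is_derive_mul.
Qed.

Lemma is_derive_dot (u v : R -> 'rV[R]_3) (s : R) du dv :
  is_derive s 1 u du -> is_derive s 1 v dv ->
  is_derive s 1 (fun r => dot (u r) (v r)) (dot du (v s) + dot (u s) dv).
Proof.
move=> /is_derive_mxP us /is_derive_mxP vs.
under [X in is_derive _ _ X]funext do rewrite dotE.
have h i := is_derive_mul (us 0 i) (vs 0 i).
apply: (is_derive_eqR (is_derive_add (is_derive_add (h 0) (h 1)) (h (1 + 1)))).
by rewrite !dotE; ring.
Qed.

Lemma is_derive_cross (u v : R -> 'rV[R]_3) (s : R) du dv :
  is_derive s 1 u du -> is_derive s 1 v dv ->
  is_derive s 1 (fun r => cross (u r) (v r)) (cross du (v s) + cross (u s) dv).
Proof.
move=> /is_derive_mxP us /is_derive_mxP vs; apply/is_derive_mxP => i j.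
under [X in is_derive _ _ X]funext do rewrite mxE.
have h k l := is_derive_mul (us 0 k) (vs 0 l).
apply: (is_derive_eqR (is_derive_sub (h (j + 1) (j + 2)) (h (j + 2) (j + 1)))).
by rewrite !mxE; ring.
Qed.

Lemma is_derive_mx_comp m n (M : R -> 'M[R]_(m, n)) (phi : R -> R) (s dphi : R) dM :
  is_derive s 1 phi dphi -> is_derive (phi s) 1 M dM ->
  is_derive s 1 (fun r => M (phi r)) (dphi *: dM).
Proof.
move=> phis /is_derive_mxP Ms; apply/is_derive_mxP => i j.
rewrite mxE mulrC.
by have := is_derive1_comp (Ms i j) phis.
Qed.

Lemma is_derive_inv (f : R -> R) (s df : R) : f s != 0 ->
  is_derive s 1 f df -> is_derive s 1 (fun r => (f r)^-1) (- df / f s ^+ 2).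
Proof.
move=> fs0 fs; apply: (is_derive_eq (is_deriveV fs0 fs)).
by rewrite /GRing.scale /= mulNr mulNr mulrC.
Qed.

Lemma is_derive_sqrt (f : R -> R) (s df : R) : 0 < f s ->
  is_derive s 1 f df ->
  is_derive s 1 (fun r => Num.sqrt (f r)) (df / (2 * Num.sqrt (f s))).
Proof.
move=> fs0 fs; rewrite mulrC.
exact: (is_derive1_comp (is_derive1_sqrt fs0) fs).
Qed.

Lemma is_derive_unique (V : normedModType R) (f : R -> V) (s : R) d1 d2 :
  is_derive s 1 f d1 -> is_derive s 1 f d2 -> d1 = d2.
Proof. by case=> _ <- [_ <-]. Qed.

Lemma derive1_is_derive (V : normedModType R) (f : R -> V) (s : R) d :
  is_derive s 1 f d -> f^`() s = d.
Proof. by rewrite derive1E => -[]. Qed.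

Lemma derivable_is_derive1 (V : normedModType R) (f : R -> V) (s : R) :
  derivable f s 1 -> is_derive s 1 f (f^`() s).
Proof. by rewrite derive1E => /derivableP. Qed.

(** Since [J] is open, the equality holds in a neighbourhood of [s]. This is what allows identities
    known only on [J] to be differentiated. *)
Lemma eq_on_is_derive (V : normedModType R) (J : set R) (f g : R -> V) (s : R) d :
  open J -> (forall r, J r -> f r = g r) -> J s ->
  is_derive s 1 f d -> is_derive s 1 g d.
Proof.
move=> oJ fg Js; apply: near_eq_is_derive.
by near=> r; apply: fg; near: r; exact: open_nbhs_nbhs.
Unshelve. all: by end_near. Qed.

Lemma derive0_eq (J : set R) (f : R -> R) :
  is_interval J -> (forall s, J s -> is_derive s 1 f (0 : R)) ->
  forall s r, J s -> J r -> f s = f r.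
Proof.
move=> iJ f0; suff le s r : s <= r -> J s -> J r -> f s = f r.
  move=> s r Js Jr; case: (leP s r) => [|/ltW] sr; first exact: le.
  by rewrite (le r s).
move=> sr Js Jr.
have Jsr x : s <= x <= r -> J x by apply: iJ.
have [] := @MVT_segment R f (fun=> 0) s r sr.
- by move=> x /[!in_itv]/= /andP[sx xr]; apply: f0; apply: Jsr; rewrite !ltW.
- apply: derivable_within_continuous => x /[!in_itv]/= xsr.
  by case: (f0 x (Jsr x xsr)).
- by move=> c _; rewrite mul0r => /eqP; rewrite subr_eq0 => /eqP.
Qed.

Lemma derive0_eq_mx (J : set R) m n (M : R -> 'M[R]_(m, n)) :
  is_interval J -> (forall s, J s -> is_derive s 1 M 0) ->
  forall s r, J s -> J r -> M s = M r.
Proof.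
move=> iJ M0 s r Js Jr; apply/matrixP => i j.
apply: (@derive0_eq J (fun r => M r i j)) => // {s r Js Jr} s /M0/is_derive_mxP.
by move=> /(_ i j); rewrite mxE.
Qed.

End Calculus.

(** * The Frenet equations of an arclength curve *)

Section Frenet.
Context {R : realType} (J : set R) (gamma : R -> 'rV[R]_3).
Hypotheses (oJ : open J) (hgamma : arclength_curve J gamma).

Local Notation T := (tangent gamma).
Local Notation N := (normal gamma).
Local Notation B := (binormal gamma).
Local Notation k := (curvature gamma).
Local Notation t := (torsion gamma).

Lemma is_derive_curve s : J s -> is_derive s 1 gamma (T s).
Proof.
by case: hgamma => sm _ _ /(sm 0%N) /derivable_is_derive1.
Qed.

Lemma is_derive_tangent s : J s -> is_derive s 1 T (k s *: N s).
Proof.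
case: hgamma => sm _ k0 Js; rewrite /normal scalerA mulfV ?k0// scale1r.
exact: derivable_is_derive1 (sm 1%N s Js).
Qed.

Lemma curvature_sqr s : k s ^+ 2 = dot (derive1 T s) (derive1 T s).
Proof. exact: enorm_sqr. Qed.

Lemma curvature_gt0 s : J s -> 0 < k s.
Proof. by case: hgamma => _ _ k0 Js; rewrite lt0r k0//= sqrtr_ge0. Qed.

(** The curvature is the square root of the squared length of the second derivative of [gamma], and
    this square is positive on [J]. *)
Lemma is_derive_curvature s : J s ->
  is_derive s 1 k (dot (derive1n 3 gamma s) (derive1n 2 gamma s) / k s).
Proof.
case: hgamma => sm _ _ Js.
have d2 : is_derive s 1 (derive1n 2 gamma) (derive1n 3 gamma s).
  exact: derivable_is_derive1 (sm 2%N s Js).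
have h0 : 0 < dot (derive1n 2 gamma s) (derive1n 2 gamma s).
  by rewrite -curvature_sqr exprn_gt0 ?curvature_gt0.
apply: (is_derive_eqR (is_derive_sqrt h0 (is_derive_dot d2 d2))).
rewrite [X in _ + X]dotC -[Num.sqrt _]/(k s).
by field; rewrite gt_eqF ?curvature_gt0.
Qed.

(** On [J] the derivative of [k] is the explicit quotient of [is_derive_curvature], whose
    ingredients are again differentiable. *)
Lemma curvature_derivable2 s : J s -> derivable k^`() s 1.
Proof.
case: hgamma => sm _ _ Js.
have d2 : is_derive s 1 (derive1n 2 gamma) (derive1n 3 gamma s).
  exact: derivable_is_derive1 (sm 2%N s Js).
have d3 : is_derive s 1 (derive1n 3 gamma) (derive1n 4 gamma s).
  exact: derivable_is_derive1 (sm 3%N s Js).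
have k0 : k s != 0 by rewrite gt_eqF ?curvature_gt0.
have [+ _] := is_derive_mul (is_derive_dot d3 d2)
  (is_derive_inv k0 (is_derive_curvature Js)).
move=> /derivable_is_derive1 h.
suff /(eq_on_is_derive oJ)/(_ Js h)[] : forall r, J r ->
  dot (derive1n 3 gamma r) (derive1n 2 gamma r) * (k r)^-1 = k^`() r by [].
by move=> r Jr; rewrite (derive1_is_derive (is_derive_curvature Jr)).
Qed.

Lemma tangent_unit s : J s -> dot (T s) (T s) = 1.
Proof. by case: hgamma => _ u _ Js; rewrite -enorm_sqr u// expr1n. Qed.

Lemma normal_unit s : J s -> dot (N s) (N s) = 1.
Proof.
move=> Js; rewrite /normal dotZl dotZr -curvature_sqr.
by field; rewrite gt_eqF ?curvature_gt0.
Qed.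

Lemma dot_unit_derive (u : R -> 'rV[R]_3) s (du : 'rV[R]_3) :
  (forall r, J r -> dot (u r) (u r) = 1) ->
  J s -> is_derive s 1 u du -> dot du (u s) = 0.
Proof.
move=> u1 Js us; have := is_derive_unique (is_derive_dot us us)
  (eq_on_is_derive  oJ (fun r Jr => esym (u1 r Jr)) Js
    (is_derive_cstR _ _)).
by rewrite (dotC (u s)); lra.
Qed.

Lemma tangent_normal s : J s -> dot (T s) (N s) = 0.
Proof.
move=> Js; have := dot_unit_derive tangent_unit Js (is_derive_tangent Js).
rewrite dotZl dotC => /eqP; rewrite mulf_eq0 gt_eqF ?curvature_gt0//=.
by move/eqP.
Qed.

Lemma binormal_unit s : J s -> dot (B s) (B s) = 1.
Proof.
move=> Js; rewrite dot_cross_cross tangent_unit// normal_unit//.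
by rewrite tangent_normal//; ring.
Qed.

Lemma frenet_expansion s x : J s ->
  x = dot x (T s) *: T s + dot x (N s) *: N s + dot x (B s) *: B s.
Proof.
by move=> Js; apply: orthonormal_expansion;
  rewrite ?tangent_unit ?normal_unit ?tangent_normal.
Qed.

(** The product rule shows that [N] is differentiable; the value it gives is dropped. The
    coordinates of [N'] in the frame come from differentiating [dot N N = 1] and [dot T N = 0], and
    from the definition of torsion. Then [B' = cross T N'], because [T'] is parallel to [N]. *)
Lemma frenet_normal_binormal s : J s ->
  is_derive s 1 N (- k s *: T s + t s *: B s) /\ is_derive s 1 B (- t s *: N s).
Proof.
move=> Js; have k0 : k s != 0 by rewrite gt_eqF ?curvature_gt0.
case: hgamma => sm _ _.
have [+ _] := is_derive_scale (is_derive_inv k0 (is_derive_curvature Js))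
  (derivable_is_derive1 (sm 2%N s Js)).
rewrite -[X in derivable X _ _]/N => /derivable_is_derive1 dN.
move: (N^`() s) dN => n dN.
have dB : is_derive s 1 B (cross (T s) n).
  apply: (is_derive_eq (is_derive_cross (is_derive_tangent Js) dN)).
  by rewrite crossZl cross_id scaler0 add0r.
have tE : t s = dot n (B s).
  by rewrite /torsion (derive1_is_derive dB) dot_cross_swap opprK.
have nN : dot n (N s) = 0 by exact: dot_unit_derive normal_unit Js dN.
have nT : dot n (T s) = - k s.
  have := is_derive_unique (is_derive_dot (is_derive_tangent Js) dN)
    (eq_on_is_derive  oJ
      (fun r Jr => esym (tangent_normal Jr)) Js (is_derive_cstR _ _)).
  by rewrite dotZl normal_unit// (dotC (T s)); lra.
have nE : n = - k s *: T s + t s *: B s.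
  by rewrite {1}(frenet_expansion n Js) nN nT -tE scale0r addr0.
split; first by rewrite -nE.
apply: (is_derive_eq dB); rewrite nE crossDr !crossZr cross_id scaler0 add0r.
rewrite cross_cross tangent_normal// tangent_unit// scale0r scale1r sub0r.
by rewrite scalerN -scaleNr.
Qed.

End Frenet.

(** * Bertrand pairs: the affine relation between torsion and curvature of the mate *)

Lemma bertrand_tangent (R : realType) (I J : set R) (gamma gammat : R -> 'rV[R]_3)
    (phi : R -> R) (lambda eps s : R) :
  open I -> arclength_curve I gamma -> open J -> arclength_curve J gammat ->
  set_fun I J phi -> smooth_on I phi ->
  (forall s, I s -> normal gamma s = eps *: normal gammat (phi s) /\
     gammat (phi s) = gamma s + lambda *: normal gamma s) ->
  I s ->
  tangent gamma s = derive1 phi s *: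
    ((1 + lambda * eps * curvature gammat (phi s)) *: tangent gammat (phi s) -
     (lambda * eps * torsion gammat (phi s)) *: binormal gammat (phi s)).
Proof.
move=> oI hgamma oJ hgammat IJ sm pair Is.
have dphi : is_derive s 1 phi (derive1 phi s) := derivable_is_derive1 (sm 0%N s Is).
have Js := IJ _ Is.
have dg := is_derive_mx_comp dphi (is_derive_curve hgammat Js).
have [dN _] := frenet_normal_binormal oJ hgammat Js.
have dM := is_derive_scale (is_derive_cst (- (lambda * eps)) s 1)
  (is_derive_mx_comp dphi dN).
(* The relation of the pair is solved for [gamma], so that differentiating it involves only the
   Frenet equations of the mate and the chain rule. *)
have E r : I r -> gammat (phi r) + - (lambda * eps) *: normal gammat (phi r) = gamma r.
  by move=> /pair[Nr ->]; rewrite Nr scalerA scaleNr addrK.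
rewrite (is_derive_unique (is_derive_curve hgamma Is)
  (eq_on_is_derive oI E Is (is_deriveD dg dM))).
by apply/rowP => i; rewrite !mxE /cst; ring.
Qed.

Lemma bertrand_linear (R : realType) (I J : set R) (gamma gammat : R -> 'rV[R]_3) :
  open_interval I -> arclength_curve I gamma ->
  open_interval J -> arclength_curve J gammat ->
  bertrand_pair I J gamma gammat -> non_planar J gammat ->
  (forall u, J u -> (curvature gammat)^`() u != 0) ->
  exists g h : R, forall u, J u -> torsion gammat u = g * curvature gammat u + h.
Proof.
move=> [oI iI [s0 Is0]] hgamma [oJ iJ _] hgammat.
move=> [phi [lambda [eps [[IJ _ sJ] sm l0 eps1 pair]]]] t0 k'0.
have eps0 : eps != 0 by case: eps1 => ->; rewrite ?oppr_eq0 oner_eq0.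
have m0 : lambda * eps != 0 by rewrite mulf_neq0.
have T_E s (Is : I s) := bertrand_tangent oI hgamma oJ hgammat IJ sm pair Is.
have T_N s : I s -> dot (tangent gamma s) (normal gammat (phi s)) = 0.
  move=> Is; have := tangent_normal oI hgamma Is.
  have [-> _] := pair _ Is; rewrite dotZr => /eqP.
  by rewrite mulf_eq0 (negPf eps0) => /eqP.
have frame u (Ju : J u) := (tangent_unit hgammat Ju, binormal_unit oJ hgammat Ju,
  dot_crossl (tangent gammat u) (normal gammat u),
  dot_crossr (tangent gammat u) (normal gammat u),
  tangent_normal oJ hgammat Ju).
(* [C] and [D] are the coordinates of the tangent of [gamma] along the tangent and binormal of the
   mate. Both are constant: each term of their derivatives is a product of a tangent or binormal
   with the common normal direction, hence zero. *)
pose C s := dot (tangent gamma s) (tangent gammat (phi s)).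
pose D s := dot (tangent gamma s) (binormal gammat (phi s)).
have CE s : I s -> C s = derive1 phi s * (1 + lambda * eps * curvature gammat (phi s)).
  move=> Is; rewrite /C T_E// dotZl -scaleNr dotDl !dotZl.
  rewrite (dotC (binormal _ _)) /binormal !(frame _ (IJ _ Is)).
  by ring.
have DE s : I s -> D s = - (derive1 phi s * (lambda * eps * torsion gammat (phi s))).
  move=> Is; rewrite /D T_E// dotZl -scaleNr dotDl !dotZl !(frame _ (IJ _ Is)).
  by ring.
have C' s : I s -> is_derive s 1 C (0 : R).
  move=> Is; have Js := IJ _ Is.
  have dphi : is_derive s 1 phi (derive1 phi s) := derivable_is_derive1 (sm 0%N s Is).
  apply: (is_derive_eqR (is_derive_dot (is_derive_tangent hgamma Is)
    (is_derive_mx_comp dphi (is_derive_tangent hgammat Js)))).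
  rewrite 2!dotZr T_N// (pair _ Is).1 2!dotZl.
  rewrite (dotC (normal _ _)) (tangent_normal oJ hgammat Js).
  by move: (curvature _ _) (derive1 _ _) (_ (phi s)) => a b c; ring.
have D' s : I s -> is_derive s 1 D (0 : R).
  move=> Is; have Js := IJ _ Is.
  have dphi : is_derive s 1 phi (derive1 phi s) := derivable_is_derive1 (sm 0%N s Is).
  have [_ dB] := frenet_normal_binormal oJ hgammat Js.
  apply: (is_derive_eqR (is_derive_dot (is_derive_tangent hgamma Is)
    (is_derive_mx_comp dphi dB))).
  rewrite 2!dotZr T_N// (pair _ Is).1 2!dotZl dot_crossr.
  by move: (curvature _ _) (derive1 _ _) (_ (phi s)) => a b c; ring.
(* By [bertrand_tangent] the unit tangent of [gamma] is a multiple of [phi']. *)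
have phi'0 s : I s -> derive1 phi s != 0.
  move=> Is; apply: contra_eq_neq (tangent_unit hgamma Is) => p0.
  by rewrite T_E// p0 scale0r dotE !mxE !mul0r !addr0 eq_sym oner_eq0.
have Ds0 : D s0 != 0.
  by rewrite DE// oppr_eq0 !mulf_neq0 ?phi'0// t0//; exact: IJ.
(* The ratio of [C] to [D] is free of [phi']; surjectivity of [phi] carries the relation to all of
   [J]. *)
have lin u : J u -> (1 + lambda * eps * curvature gammat u) * D s0 =
    - (lambda * eps * torsion gammat u) * C s0.
  move=> /sJ[s Is <-]; apply: (mulfI (phi'0 s Is)).
  have -> : derive1 phi s * (- (lambda * eps * torsion gammat (phi s)) * C s0) =
      D s * C s0 by rewrite DE// mulrA mulrN.
  by rewrite mulrA -CE// (derive0_eq iI C' Is Is0) (derive0_eq iI D' Is Is0) mulrC.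
(* If [C] vanished, [lin] would force the curvature of the mate to be the constant
   [- (lambda * eps)^-1], against the non-vanishing of its derivative. *)
have Cs0 : C s0 != 0.
  apply/eqP => C0; have Ju := IJ _ Is0.
  have kc u : J u -> - (lambda * eps)^-1 = curvature gammat u.
    move=> /lin; rewrite C0 mulr0 => /eqP.
    rewrite mulf_eq0 (negPf Ds0) orbF => /eqP k1.
    by apply: (mulfI m0); rewrite mulrN divff//; lra.
  have := k'0 _ Ju; rewrite (derive1_is_derive
    (eq_on_is_derive (f := fun=> _) oJ kc Ju (is_derive_cst _ _ _))).
  by rewrite eqxx.
(* These are the coefficients obtained by solving [lin] for the torsion. *)
exists (- D s0 / C s0), (- D s0 / (lambda * eps * C s0)) => u /lin E.
apply: (mulIf (mulf_neq0 m0 Cs0)).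
have -> : torsion gammat u * (lambda * eps * C s0) =
  - ((1 + lambda * eps * curvature gammat u) * D s0) by rewrite E; ring.
by field; apply/and3P; split; rewrite ?Cs0//.
Qed.

Lemma is_derive_dotl (R : realType) (d : 'rV[R]_3) (u : R -> 'rV[R]_3) (s : R)
    (du : 'rV[R]_3) :
  is_derive s 1 u du -> is_derive s 1 (fun r => dot d (u r)) (dot d du).
Proof.
move=> us; apply: (is_derive_eqR (is_derive_dot (is_derive_cst d s 1) us)).
by rewrite dot0l add0r.
Qed.

(** Corresponding normals differ by the sign [eps], so the same [d] serves for both curves and the
    offset is multiplied by [eps]. Surjectivity of [phi] gives the direction from [I] to [J]. *)
Lemma bertrand_lies_in_plane (R : realType) (I J : set R)
    (gamma gammat : R -> 'rV[R]_3) : bertrand_pair I J gamma gammat ->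
  lies_in_plane I (normal gamma) <-> lies_in_plane J (normal gammat).
Proof.
move=> [phi [lambda [eps [[IJ _ sJ] _ _ eps1 pair]]]].
have eps2 : eps * eps = 1 by case: eps1 => ->; ring.
split=> -[d [c [d0 dc]]]; exists d, (eps * c); split => //.
  move=> u /sJ[s Is <-]; rewrite -(dc s Is) (pair s Is).1 dotZr.
  by rewrite mulrA eps2 mul1r.
by move=> s Is; rewrite (pair s Is).1 dotZr dc//; exact: IJ.
Qed.

(** * Planarity of the normal indicatrix when the torsion is affine in the curvature *)

Section PlanarNormal.
Context {R : realType} (J : set R) (gamma : R -> 'rV[R]_3) (g h : R).
Hypotheses (hJ : open_interval J) (hgamma : arclength_curve J gamma).
Hypothesis torsionE : forall s, J s -> torsion gamma s = g * curvature gamma s + h.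

Local Notation T := (tangent gamma).
Local Notation N := (normal gamma).
Local Notation B := (binormal gamma).
Local Notation k := (curvature gamma).
Local Notation t := (torsion gamma).
Local Notation k' := (derive1 k).
Local Notation k'' := (derive1 k').

Let oJ : open J. Proof. by case: hJ. Qed.

Let is_derive_k s : J s -> is_derive s 1 k (k' s).
Proof.
move=> Js; apply: derivable_is_derive1.
by case: (is_derive_curvature hgamma Js).
Qed.

Let is_derive_k' s : J s -> is_derive s 1 k' (k'' s).
Proof.
by move=> Js; apply: derivable_is_derive1; exact: curvature_derivable2 hgamma _ Js.
Qed.

Lemma is_derive_torsion s : J s -> is_derive s 1 t (g * k' s).
Proof.
move=> Js; apply: (eq_on_is_derive oJ (fun r Jr => esym (torsionE Jr)) Js).
apply: (is_derive_eqR (is_derive_add (is_derive_mul (is_derive_cstR g s)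
  (is_derive_k Js)) (is_derive_cstR h s))).
by ring.
Qed.

Lemma planar_normal_curvature : h != 0 -> lies_in_plane J N ->
  forall s, J s -> (k s ^+ 2 + t s ^+ 2) * k'' s = 3 * k' s ^+ 2 * (k s + g * t s).
Proof.
move=> h0 [d [c [d0 dN]]].
(* With the constant [c] along [N], these are the coordinates of [d] in the frame. [E1], [E2] and
   [E3] are the successive derivatives of [dot d N = c]. *)
pose a s := dot d (T s); pose b s := dot d (B s).
have a' s : J s -> is_derive s 1 a (k s * c).
  move=> Js; apply: (is_derive_eqR (is_derive_dotl d (is_derive_tangent hgamma Js))).
  by rewrite dotZr dN.
have b' s : J s -> is_derive s 1 b (- t s * c).
  move=> Js; have [_ dB] := frenet_normal_binormal oJ hgamma Js.
  by apply: (is_derive_eqR (is_derive_dotl d dB)); rewrite dotZr dN.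
have E1 s : J s -> k s * a s = t s * b s.
  move=> Js; have [dNs _] := frenet_normal_binormal oJ hgamma Js.
  have := is_derive_unique (is_derive_dotl d dNs)
    (eq_on_is_derive oJ (fun r Jr => esym (dN r Jr)) Js (is_derive_cstR c s)).
  rewrite dotDr !dotZr -/(a s) -/(b s) mulNr addrC => /eqP.
  by rewrite subr_eq0 => /eqP.
have E2 s : J s -> k' s * (g * b s - a s) = (k s ^+ 2 + t s ^+ 2) * c.
  move=> Js; have := is_derive_unique
    (is_derive_mul (is_derive_k Js) (a' s Js))
    (eq_on_is_derive oJ (fun r Jr => esym (E1 r Jr)) Js
      (is_derive_mul (is_derive_torsion Js) (b' s Js))).
  move: (k s) (t s) (k' s) (a s) (b s) => ks ts k's x y; lra.
have E3 s : J s -> k'' s * (g * b s - a s) = 3 * k' s * (k s + g * t s) * c.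
  move=> Js; have dk := is_derive_k Js; have dt := is_derive_torsion Js.
  have := is_derive_unique
    (is_derive_mul (is_derive_k' Js) (is_derive_sub
      (is_derive_mul (is_derive_cstR g s) (b' s Js)) (a' s Js)))
    (eq_on_is_derive oJ (fun r Jr => esym (E2 r Jr)) Js
      (is_derive_mul (is_derive_add (is_derive_mul dk dk) (is_derive_mul dt dt))
        (is_derive_cstR c s))).
  move: (k s) (t s) (k' s) (k'' s) (a s) (b s) => ks ts k's k''s x y; lra.
move=> s Js; set q := g * b s - a s.
(* If [q = 0], then [E2] gives [c = 0], and [E1] with [a = g * b] reduces to [h * b = 0]. All
   coordinates of [d] then vanish. *)
have q0 : q != 0.
  apply/eqP => q0; have k0 := curvature_gt0 hgamma Js.
  have c0 : c = 0.
    have /esym/eqP := E2 s Js; rewrite -/q q0 mulr0 mulf_eq0 gt_eqF/= => [/eqP//|].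
    by rewrite ltr_wpDr ?sqr_ge0// exprn_gt0.
  have aE : a s = g * b s by move: q0; rewrite /q => /eqP; rewrite subr_eq0 => /eqP.
  have /eqP : h * b s = 0.
    have := E1 s Js; rewrite aE torsionE//.
    move: (k s) (b s) => ks y; lra.
  rewrite mulf_eq0 (negPf h0) => /eqP b0.
  move/eqP: d0; apply; rewrite (frenet_expansion oJ hgamma d Js).
  by rewrite dN// -/(a s) -/(b s) aE b0 c0 mulr0 !scale0r !addr0.
(* After multiplication by [q], [E3] on the left and [E2] on the right make both sides [3 * k' * (k
   + g * t) * (k ^+ 2 + t ^+ 2) * c]. *)
apply: (mulIf q0); have := E3 s Js; have := E2 s Js; rewrite -/q.
move: q (k s) (t s) (k' s) (k'' s) {q0} => q ks ts k's k''s e2 e3.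
transitivity ((ks ^+ 2 + ts ^+ 2) * (k''s * q)); first by ring.
rewrite e3; transitivity (3 * k's * (ks + g * ts) * (k's * q)); last by ring.
by rewrite e2; ring.
Qed.

(* The vector [D] below is the direction of [N' x N'']. *)
Lemma curvature_planar_normal :
  (forall s, J s -> t s != 0) ->
  (forall s, J s -> (k s ^+ 2 + t s ^+ 2) * k'' s = 3 * k' s ^+ 2 * (k s + g * t s)) ->
  lies_in_plane J N.
Proof.
move=> t0 ode; case: hJ => _ iJ [s0 Js0].
pose w s := k s * k s + t s * t s.
have w0 s : J s -> 0 < w s.
  move=> Js; have k0 := curvature_gt0 hgamma Js.
  by rewrite /w -!expr2 ltr_wpDr ?sqr_ge0// exprn_gt0.
(* With [r] as a separate quantity, what follows is polynomial modulo [r ^+ 2 * w = 1]. *)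
pose r s := (Num.sqrt (w s))^-1.
have rw s : J s -> r s ^+ 2 * w s = 1.
  by move=> Js; rewrite exprVn sqr_sqrtr ?ltW ?w0// mulVf// gt_eqF ?w0.
have r' s : J s -> is_derive s 1 r (- (k' s * (k s + g * t s) * r s ^+ 3)).
  move=> Js; have dk := is_derive_k Js; have dt := is_derive_torsion Js.
  have sw0 : Num.sqrt (w s) != 0 by rewrite gt_eqF// sqrtr_gt0 w0.
  have dw : is_derive s 1 w _ :=
    is_derive_add (is_derive_mul dk dk) (is_derive_mul dt dt).
  apply: (is_derive_eqR (is_derive_inv (f := fun x => Num.sqrt (w x)) sw0
    (is_derive_sqrt (w0 s Js) dw))).
  rewrite /r; move: (Num.sqrt (w s)) (k s) (t s) (k' s) sw0 => sw ks ts k's sw0.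
  by field.
pose p s := k' s * (r s * (r s * r s)).
have p' s : J s -> is_derive s 1 p (0 : R).
  move=> Js; have dr := r' s Js.
  apply: (is_derive_eqR (is_derive_mul (is_derive_k' Js)
    (is_derive_mul dr (is_derive_mul dr dr)))).
  have := ode s Js; have := rw s Js; rewrite /w.
  move: (r s) (k s) (t s) (k' s) (k'' s) => rs ks ts k's k''s e1 e2.
  (* The factor 1 is kept so that [e1] can replace it by [r ^+ 2 * w]; [e2] then makes the two terms
     cancel. *)
  transitivity (rs ^+ 3 * (k''s * 1 - rs ^+ 2 * (3 * k's ^+ 2 * (ks + g * ts)))).
    by ring.
  by rewrite -e2 -e1; ring.
pose D s := (t s * r s) *: T s + ((- h * p s) *: N s + (k s * r s) *: B s).
have D' s : J s -> is_derive s 1 D 0.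
  move=> Js; have [dN dB] := frenet_normal_binormal oJ hgamma Js.
  apply: (is_derive_eq (is_deriveD
    (is_derive_scale (is_derive_mul (is_derive_torsion Js) (r' s Js))
      (is_derive_tangent hgamma Js))
    (is_deriveD
      (is_derive_scale (is_derive_mul (is_derive_cstR (- h) s) (p' s Js)) dN)
      (is_derive_scale (is_derive_mul (is_derive_k Js) (r' s Js)) dB)))).
  have := rw s Js; have := torsionE Js; rewrite /w /p.
  move: (r s) (k s) (t s) (k' s) (T s) (N s) (B s) => rs ks ts k's x y z e1 e2.
  (* Once [h] is eliminated, the [N] terms cancel, and the [T] and [B] terms share the factor
     [1 - r ^+ 2 * w], which is zero. *)
  have eh : h = ts - g * ks by rewrite e1; ring.
  apply/rowP => i; rewrite !mxE eh.
  move: (x 0 i) (y 0 i) (z 0 i) => xi yi zi.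
  transitivity (k's * rs * (1 - rs ^+ 2 * (ks * ks + ts * ts)) * (g * xi + zi)).
    by ring.
  by rewrite e2; ring.
have Dc s : J s -> D s0 = D s by move=> Js; exact: derive0_eq_mx iJ D' _ _ Js0 Js.
have DT s : J s -> dot (D s) (T s) = t s * r s.
  move=> Js; rewrite 2!dotDl 3!dotZl (tangent_unit hgamma Js).
  rewrite (dotC (N s)) (tangent_normal oJ hgamma Js) (dotC (B s)).
  by rewrite dot_crossl !mulr0 mulr1 !addr0.
have DN s : J s -> dot (D s) (N s) = - h * p s.
  move=> Js; rewrite 2!dotDl 3!dotZl (normal_unit hgamma Js).
  rewrite (tangent_normal oJ hgamma Js) (dotC (B s)).
  by rewrite dot_crossr !mulr0 mulr1 addr0 add0r.
exists (D s0), (- h * p s0); split.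
  (* The coordinate of [D] along [T] is [t * r], with [r] positive, so [D = 0] would make the
     torsion vanish. *)
  apply: contraTneq (t0 s0 Js0) => D0; rewrite negbK.
  have /eqP := DT s0 Js0; rewrite D0 dot0l.
  by rewrite eq_sym mulf_eq0 orbC invr_eq0 gt_eqF// sqrtr_gt0 w0.
move=> s Js; rewrite (Dc s Js) (DN s Js); apply: (congr1 (fun x => - h * x)).
exact: derive0_eq iJ p' s s0 Js Js0.
Qed.

End PlanarNormal.

(** * The characterization in terms of [f] and [g] *)

Theorem theorem8 (R : realType) (I J : set R) (gamma gammat : R -> 'rV[R]_3)
    (hI : open_interval I) (hJ : open_interval J)
    (hgamma : arclength_curve I gamma)
    (hgammat : arclength_curve J gammat)
    (hpair : bertrand_pair I J gamma gammat)
    (hhel : non_helical I gamma) (hhelt : non_helical J gammat)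
    (hpla : non_planar I gamma) (hplat : non_planar J gammat) :
  let kappa := curvature gammat in
  let tau := torsion gammat in
  let f := fun s => tau s / kappa s in
  let kappa' := kappa^`() in
  let kappa'' := kappa^`(2) in
  let tau' := tau^`() in
  let g := fun s => tau' s / kappa' s in
  (forall s, J s -> [/\ kappa' s != 0, f s != 0 & g s != f s]) ->
  (lies_in_plane I (normal gamma) <->
   forall s, J s ->
     kappa s * kappa'' s * f s ^+ 2
       - 3 * kappa' s ^+ 2 * g s * f s
       - (3 * kappa' s ^+ 2 - kappa s * kappa'' s) = 0).
Proof.
move=> kappa tau f kappa' kappa'' tau' g nz.
have k'0 s : J s -> kappa' s != 0 by move=> /nz[].
have [c [h torsionE]] := bertrand_linear hI hgamma hJ hgammat hpair hplat k'0.
have k0 s : J s -> kappa s != 0.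
  by move=> Js; rewrite gt_eqF ?(curvature_gt0 hgammat).
have gE s : J s -> g s = c.
  move=> Js; rewrite /g /tau'.
  rewrite (derive1_is_derive (is_derive_torsion hJ hgammat torsionE Js)).
  by rewrite mulfK ?k'0.
(* If [h = 0], then [f] and [g] would both equal [c] at a point of the nonempty [J]. *)
have h0 : h != 0.
  case: hJ => _ _ [s Js]; have [_ _] := nz s Js; apply: contra_neq => h0.
  by rewrite gE// /f /tau torsionE// h0 addr0 mulfK// k0.
(* With [g = c] and [f = tau / kappa], clearing the denominator [kappa] leaves the differential
   equation used in the two planarity lemmas. *)
have odeE s : J s ->
    kappa s * kappa'' s * f s ^+ 2 - 3 * kappa' s ^+ 2 * g s * f s
      - (3 * kappa' s ^+ 2 - kappa s * kappa'' s) =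
    ((kappa s ^+ 2 + tau s ^+ 2) * kappa'' s
      - 3 * kappa' s ^+ 2 * (kappa s + c * tau s)) / kappa s.
  move=> Js; rewrite gE// /f; have := k0 s Js.
  by move: (kappa s) (tau s) (kappa' s) (kappa'' s) => ks ts k's k''s ks0; field.
rewrite (bertrand_lies_in_plane hpair); split.
  move=> /(planar_normal_curvature hJ hgammat torsionE h0) ode s Js.
  by rewrite odeE// ode// subrr mul0r.
move=> ode; apply: (curvature_planar_normal hJ hgammat torsionE hplat) => s Js.
have /eqP := ode s Js; rewrite odeE// mulf_eq0 invr_eq0 (negPf (k0 s Js)) orbF.
by rewrite subr_eq0 => /eqP.
Qed.
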